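(* For each $n\ge 2$, let $A_{n,1},\ldots,A_{n,n}$ be exchangeable events, and let $$Y_n:=\sum_{j=1}^n\mathbb{I}\{A_{n,j}\}.$$ If, for some $\nu\in(0,\infty)$, $$\lim_{n\to\infty}n^k\,\mathbb{P}\left(A_{n,1}\cap\cdots\cap A_{n,k}\right)=\nu^k\quad\text{for each integer }k\ge 1,$$ then $Y_n$ converges in distribution, as $n\to\infty$, to a random variable $Y$ having the Poisson distribution with parameter $\nu$.
   Context: Events $A_{n,1},\ldots,A_{n,n}$ (on a common probability space for each fixed $n$) are exchangeable if the joint distribution of their indicators $(\mathbb{I}\{A_{n,1}\},\ldots,\mathbb{I}\{A_{n,n}\})$ is invariant under permutations of the indices; in particular $\mathbb{P}(A_{n,i_1}\cap\cdots\cap A_{n,i_k})=\mathbb{P}(A_{n,1}\cap\cdots\cap A_{n,k})$ for all $1\le i_1<\cdots<i_k\le n$. $\mathbb{I}\{\cdot\}$ is the indicator function. In the limit for fixed $k$, only $n\ge k$ is considered. *)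

(* Defs.v *)
From HB Require Import structures.
From mathcomp Require Import all_boot all_order all_algebra perm.
From mathcomp Require Import all_classical all_reals all_analysis.
From mathcomp Require Import measurable_realfun.

Set Implicit Arguments.
Unset Strict Implicit.
Unset Printing Implicit Defensive.

Import Order.TTheory GRing.Theory Num.Theory.
Import numFieldNormedType.Exports.

Local Open Scope classical_set_scope.
Local Open Scope ring_scope.

Definition exchangeable_events (R : realType) (d : measure_display)
    (T : measurableType d) (P : probability T R) (n : nat)
    (A : 'I_n -> set T) : Prop :=
  forall (s : 'S_n) (B : set (n.-tuple R)), measurable B ->
    pushforward P (fun w => [tuple \1_(A (s j)) w : R | j < n]) B =
    pushforward P (fun w => [tuple \1_(A j) w : R | j < n]) B.

Definition event_count (R : realType) (d : measure_display)
    (T : measurableType d) (P : probability T R) (n : nat)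
    (A : 'I_n -> set T) (mA : forall j, measurable (A j)) : {RV P >-> R} :=
  \sum_(j < n) indic_mfun (A j) (mA j).

Definition cvg_in_distribution (R : realType) (d : nat -> measure_display)
    (T : forall n, measurableType (d n)) (P : forall n, probability (T n) R)
    (X : forall n, {RV (P n) >-> R}) (d' : measure_display)
    (T' : measurableType d') (Q : probability T' R) (Y : {RV Q >-> R}) : Prop :=
  forall x : R, {for x, continuous (cdf Y)} ->
    cdf (X n) x @[n --> \oo] --> cdf Y x.

(* The second argument of poisson_prob is unused in the library definition. *)
Definition poisson_distributed (R : realType) (nu : R) (d : measure_display)
    (T : measurableType d) (Q : probability T R) (Y : {RV Q >-> R}) : Prop :=
  forall B : set R, measurable B ->
    distribution Q Y B =
    pushforward (poisson_prob nu 0%N) (fun m : nat => m%:R : R) B.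

Lemma event_countE (R : realType) (d : measure_display)
    (T : measurableType d) (P : probability T R) (n : nat)
    (A : 'I_n -> set T) (mA : forall j, measurable (A j)) (w : T) :
  event_count P mA w = \sum_(j < n) \1_(A j) w.
Proof.
by rewrite /event_count mfun_sum.
Qed.

Lemma poisson_distributed_exists (R : realType) (nu : R) :
  exists (d : measure_display) (T : measurableType d) (Q : probability T R)
    (Y : {RV Q >-> R}), poisson_distributed nu Y.
Proof.
have mY : measurable_fun [set: nat] (fun m => m%:R : R) by [].
pose Y : {mfun nat >-> R} := HB.pack (fun m : nat => m%:R : R)
  (@isMeasurableFun.Build _ _ nat R _ mY).
by exists _, nat, (poisson_prob nu 0%N), Y.
Qed.

(* Main.v *)
(** Let [p m] be the probability that exactly [m] of the events occur and [b k]
    the k-th binomial moment of the number of occurring events.  By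
    exchangeability [b k] equals ['C(n, k)] times the probability that the first
    [k] events occur, so it tends to [nu ^+ k / k`!].  Bonferroni's inequalities
    bound the distance from [p m] to the alternating sum of
    ['C(m + i, m) * b (m + i)] over [i <= r] by ['C(m + r, m) * b (m + r)].
    Let n tend to infinity, then r: the sum becomes the exponential series of
    [- nu] times [nu ^+ m / m`!], and the bound vanishes because it is a term of
    the exponential series of [nu], up to the same factor. *)
Require Import Defs.
From HB Require Import structures.
From mathcomp Require Import all_boot all_order all_algebra perm.
From mathcomp Require Import all_classical all_reals all_analysis.
From mathcomp Require Import ring lra.

Import Order.TTheory GRing.Theory Num.Theory.
Import numFieldNormedType.Exports.

Local Open Scope classical_set_scope.
Local Open Scope ring_scope.

(** * Binomial coefficients and Bonferroni's inequalities *)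

Lemma mul_bin_trinomial (n m i : nat) :
  ('C(m + i, m) * 'C(m + n, m + i) = 'C(m + n, m) * 'C(n, i))%N.
Proof.
case: (leqP i n) => [in_|ni]; last first.
  by rewrite (bin_small ni) (@bin_small (m + n)) ?ltn_add2l ?muln0.
have h1 := bin_fact (leq_addr i m).
have h2 : ('C(m + n, m + i) * ((m + i)`! * (n - i)`!) = (m + n)`!)%N.
  by rewrite -(subnDl m n i); apply: bin_fact; rewrite leq_add2l.
have h3 := bin_fact (leq_addr n m).
have h4 := bin_fact in_.
rewrite !addKn in h1 h3.
(* Multiplied by this product, both sides become the factorial of [m + n]. *)
have f0 : (0 < m`! * (i`! * (n - i)`!))%N by rewrite !muln_gt0 !fact_gt0.
apply/eqP; rewrite -(eqn_pmul2r f0); apply/eqP.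
rewrite [RHS](_ : _ = ('C(m + n, m) * (m`! * ('C(n, i) * (i`! * (n - i)`!))))%N);
  last by ring.
rewrite h4 h3 -h2 -h1; ring.
Qed.

(** Pascal's rule makes the sum telescope. *)
Lemma sum_signed_bin (R : pzRingType) (n r : nat) :
  \sum_(i < r.+1) (-1) ^+ i * 'C(n.+1, i)%:R = (-1) ^+ r * 'C(n, r)%:R :> R.
Proof.
elim: r => [|r IH]; first by rewrite big_ord1 !bin0.
rewrite big_ord_recr /= IH binS natrD mulrDr addrCA exprS mulN1r !mulNr.
by rewrite subrr addr0.
Qed.

(** Bonferroni's inequalities at a single outcome, with [j] the number of events that occur. For
    [j = m + n] the trinomial identity factors out ['C(m + n, m)] and leaves an alternating partial
    sum of row [n]; for positive [n] this is ['C(n.-1, r)] up to sign, hence at most ['C(n, r)] in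
    absolute value. *)
Lemma bonferroni_bin (R : realDomainType) (j m r : nat) :
  `|(j == m)%:R - \sum_(i < r.+1) (-1) ^+ i * 'C(m + i, m)%:R * 'C(j, m + i)%:R|
  <= 'C(m + r, m)%:R * 'C(j, m + r)%:R :> R.
Proof.
case: (ltnP j m) => [jm|/subnKC <-].
  rewrite ltn_eqF // big1 ?subrr ?normr0 ?mulr_ge0 // => i _.
  by rewrite (bin_small (ltn_addr i jm)) mulr0.
set n := (j - m)%N.
under eq_bigr => i _ do rewrite -mulrA -natrM mul_bin_trinomial natrM mulrCA.
rewrite -mulr_sumr -natrM mul_bin_trinomial natrM.
case: n => [|n].
  rewrite addn0 eqxx binn !mul1r big_ord_recl big1 ?addr0 => [|i _].
    by rewrite bin0 mulr1 subrr normr0.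
  by rewrite bin0n mulr0.
rewrite -{1}[m in _ == m]addn0 eqn_add2l sub0r normrN sum_signed_bin normrM.
rewrite normrM normrX normrN1 expr1n mul1r !normr_nat.
by rewrite ler_wpM2l // ler_nat leq_bin2l.
Qed.

(** * Limits: falling factorials and the method of moments *)

Lemma cvg_bigsum {R : realType} {I J : Type} {F : set_system I} {FF : Filter F}
    (r : seq J) {D : pred J} {f : J -> I -> R} {l : J -> R} :
  (forall j, D j -> f j i @[i --> F] --> l j) ->
  \sum_(j <- r | D j) f j i @[i --> F] --> \sum_(j <- r | D j) l j.
Proof. by move=> fl; apply: cvg_big => //; exact: add_continuous. Qed.

Lemma cvg_bigprod {R : realType} {I J : Type} {F : set_system I} {FF : Filter F}
    (r : seq J) {D : pred J} {f : J -> I -> R} {l : J -> R} :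
  (forall j, D j -> f j i @[i --> F] --> l j) ->
  \prod_(j <- r | D j) f j i @[i --> F] --> \prod_(j <- r | D j) l j.
Proof. by move=> fl; apply: cvg_big => //; exact: mul_continuous. Qed.

(** The ratio is a product of [k] factors [(n - i) / n], each tending to 1. *)
Lemma cvg_ffact_ratio (R : realType) (k : nat) :
  (n ^_ k)%:R / n%:R ^+ k @[n --> \oo] --> (1 : R).
Proof.
rewrite -cvg_shiftS /=.
have -> : (fun n : nat => (n.+1 ^_ k)%:R / n.+1%:R ^+ k : R) =
          (fun n : nat => \prod_(i < k) ((n.+1 - i)%N%:R / n.+1%:R)).
  apply/funext => n; rewrite ffact_prod natr_prod prodf_div.
  by rewrite prodr_const card_ord.
suff cvg1 (i : 'I_k) : (n.+1 - i)%N%:R / n.+1%:R @[n --> \oo] --> (1 : R).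
  have := cvg_bigprod (F := \oo) (index_enum _) (D := predT) (fun i _ => cvg1 i).
  by rewrite big1_eq; apply.
(* Truncated subtraction agrees with real subtraction once [i <= n.+1]. *)
apply: (@cvg_trans _ ((1 - i%:R * n.+1%:R^-1 : R) @[n --> \oo])).
  apply: near_eq_cvg; near=> n.
  have le_in : (i <= n.+1)%N by apply: leqW; near: n; exact: nbhs_infty_ge.
  by rewrite natrB // mulrBl divff.
have := cvgB (cvg_cst (1 : R)) (cvgMl_tmp (a := i%:R) (@cvg_harmonic R)).
by rewrite mulr0 subr0 => h; exact: h.
Unshelve. all: by end_near.
Qed.

(** The method of moments on finite weighted sets: [w n] stands for a law and [N n] for the count.
    At [k = 0] the hypothesis says that the total mass tends to 1. *)
Lemma poisson_limit_binomial_moments {R : realType} {I : nat -> finType}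
    {w : forall n, I n -> R} {N : forall n, I n -> nat} {nu : R} :
  (forall n i, 0 <= w n i) ->
  (forall k, \sum_i w n i * 'C(N n i, k)%:R @[n --> \oo] --> nu ^+ k / k`!%:R) ->
  forall m, \sum_(i | N n i == m) w n i @[n --> \oo]
    --> nu ^+ m / m`!%:R * expR (- nu).
Proof.
move=> w0 momw m.
pose b n k : R := \sum_i w n i * 'C(N n i, k)%:R.
pose p n : R := \sum_(i | N n i == m) w n i.
pose S n r : R := \sum_(i < r.+1) (-1) ^+ i * 'C(m + i, m)%:R * b n (m + i)%N.
(* The pointwise Bonferroni bound, summed against the nonnegative weights [w n]. *)
have pS n r : `|p n - S n r| <= 'C(m + r, m)%:R * b n (m + r)%N.
  have -> : p n - S n r = \sum_j w n j * ((N n j == m)%:R -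
      \sum_(i < r.+1) (-1) ^+ i * 'C(m + i, m)%:R * 'C(N n j, m + i)%:R).
    under [RHS]eq_bigr => j _ do rewrite mulrBr mulr_sumr.
    rewrite sumrB; congr (_ - _).
      rewrite /p big_mkcond; apply: eq_bigr => j _.
      by case: eqP; rewrite ?mulr1 ?mulr0.
    rewrite exchange_big; apply: eq_bigr => i _.
    by rewrite mulr_sumr; apply: eq_bigr => j _; rewrite mulrCA.
  rewrite mulr_sumr (le_trans (ler_norm_sum _ _ _))// ler_sum// => j _.
  by rewrite normrM ger0_norm// mulrCA ler_wpM2l// bonferroni_bin.
have binl k : 'C(m + k, m)%:R * (nu ^+ (m + k) / (m + k)`!%:R) =
    nu ^+ m / m`!%:R * exp_coeff nu k.
  have := bin_fact (leq_addr k m); rewrite addKn => /(congr1 (fun n => n%:R : R)).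
  rewrite !natrM /exp_coeff /= => <-.
  have ? : (m`!)%:R != 0 :> R by rewrite pnatr_eq0 -lt0n fact_gt0.
  have ? : (k`!)%:R != 0 :> R by rewrite pnatr_eq0 -lt0n fact_gt0.
  have ? : ('C(m + k, m))%:R != 0 :> R by rewrite pnatr_eq0 -lt0n bin_gt0 leq_addr.
  by rewrite exprD; field; apply/and3P.
have cb k : 'C(m + k, m)%:R * b n (m + k)%N @[n --> \oo] -->
    nu ^+ m / m`!%:R * exp_coeff nu k.
  by rewrite -binl; apply: cvgMl_tmp; exact: momw.
have cS r : S n r @[n --> \oo] -->
    nu ^+ m / m`!%:R * series (exp_coeff (- nu)) r.+1.
  rewrite /series/= big_mkord mulr_sumr; apply: cvg_bigsum => i _.
  have -> : nu ^+ m / m`!%:R * exp_coeff (- nu) i =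
      (-1) ^+ i * (nu ^+ m / m`!%:R * exp_coeff nu i).
    by rewrite /exp_coeff /= (exprNn nu); ring.
  under eq_fun do rewrite -mulrA.
  by apply: cvgMl_tmp; exact: cb.
have cE : nu ^+ m / m`!%:R * series (exp_coeff (- nu)) r.+1 @[r --> \oo] -->
    nu ^+ m / m`!%:R * expR (- nu).
  apply: cvgMl_tmp; rewrite (cvg_shiftS (series (exp_coeff (- nu)))).
  exact: is_cvg_series_exp_coeff.
have c0 : nu ^+ m / m`!%:R * exp_coeff nu r @[r --> \oo] --> 0.
  have := cvgMl_tmp (a := nu ^+ m / m`!%:R) (cvg_exp_coeff nu).
  by rewrite mulr0 => h; exact: h.
apply/cvgrPdist_le => e e0.
(* Four errors add up: the tail of the exponential series, the distance from [S n r] to its limit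
   and, for the Bonferroni bound, its distance to its limit and the size of that limit. First [r] is
   fixed, then [n] grows. *)
have e4 : 0 < e / 4 by rewrite divr_gt0.
have [r [rE r0]] : exists r,
  `|nu ^+ m / m`!%:R * expR (- nu) -
    nu ^+ m / m`!%:R * series (exp_coeff (- nu)) r.+1| <= e / 4 /\
  `|0 - nu ^+ m / m`!%:R * exp_coeff nu r| <= e / 4.
  move/cvgrPdist_le : cE => /(_ _ e4) cE; move/cvgrPdist_le : c0 => /(_ _ e4) c0.
  by have [r _ /(_ r (leqnn r))] := filterI cE c0; exists r.
move/cvgrPdist_le : (cS r) => /(_ _ e4) cSr.
move/cvgrPdist_le : (cb r) => /(_ _ e4) cbr.
near=> n.
have hS : `|nu ^+ m / m`!%:R * series (exp_coeff (- nu)) r.+1 - S n r| <= e / 4.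
  by near: n.
have hb : `|nu ^+ m / m`!%:R * exp_coeff nu r -
    'C(m + r, m)%:R * b n (m + r)%N| <= e / 4.
  by near: n.
have := pS n r; rewrite -/(p n).
move: rE r0 hS hb.
rewrite !ler_norml.
move: (_ * expR _) (_ * series _ _) (_ * exp_coeff _ _) (_ * b _ _) (S n r) (p n).
move=> ? ? ? ? ? ? /andP[? ?] /andP[? ?] /andP[? ?] /andP[? ?] /andP[? ?].
by apply/andP; split; lra.
Unshelve. all: by end_near.
Qed.

(** * Reduction to a finite set: the law of the random set of occurring indices *)

Definition occurring {T : Type} {n : nat} (A : 'I_n -> set T) (w : T) :
    {set 'I_n} :=
  finset (fun j => w \in A j).

Lemma in_occurring {T : Type} {n : nat} (A : 'I_n -> set T) (w : T) (j : 'I_n) :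
  (j \in occurring A w) = (w \in A j).
Proof. by rewrite /occurring inE. Qed.

Lemma measurable_occurring {d : measure_display} {T : measurableType d} {n : nat}
    {A : 'I_n -> set T} (mA : forall j, measurable (A j)) (U : {set 'I_n}) :
  measurable [set w | occurring A w = U].
Proof.
have -> : [set w | occurring A w = U] =
    \bigcap_(j in [set: 'I_n]) (if j \in U then A j else ~` A j).
  apply/seteqP; split => [w <- j _|w AU].
    by rewrite inE; case: ifPn => [/set_mem|/negP Aw /mem_set].
  apply/setP => j; rewrite inE; have := AU j I.
  by case: ifPn => jU; [move/mem_set|move=> Aw; apply/negP => /set_mem].
apply: fin_bigcap_measurable => [|j _]; first exact: finite_finset.
by case: ifP => // _; exact: measurableC.
Qed.

(** The fibres of [occurring A] form a finite measurable partition, so additivity applies. *)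
Lemma measure_occurring {d : measure_display} {T : measurableType d} {R : realType}
    (P : probability T R) {n : nat} {A : 'I_n -> set T}
    (mA : forall j, measurable (A j)) (D : pred {set 'I_n}) :
  fine (P [set w | D (occurring A w)]) =
  \sum_(U | D U) fine (P [set w | occurring A w = U]).
Proof.
have mO := measurable_occurring mA.
rewrite sum_fine => [|U _]; last exact: fin_num_measure.
rewrite (bigfs _ (index_enum_uniq _)) => [|U _]; last by rewrite mem_index_enum.
rewrite -measure_fin_bigcup//.
- congr (fine (P _)); apply/seteqP; split => [w Dw|w [U DU wU]].
    by exists (occurring A w).
  by rewrite /= wU.
- by move=> U V _ _ [w [<- <-]].
Qed.

(** The permutation lists the elements of [S] first, then those of its complement. *)
Lemma perm_initial_segment {n : nat} (S : {set 'I_n}) :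
  exists s : 'S_n, forall j, (s j \in S) = (j < #|S|)%N.
Proof.
pose l := enum S ++ enum (~: S)%SET.
have sz_l : size l == n by rewrite size_cat -!cardE cardsC card_ord.
have uniq_l : uniq l.
  rewrite cat_uniq !enum_uniq andbT /=; apply/hasPn => j.
  by rewrite !mem_enum inE.
have inj_l : injective (tnth (Tuple sz_l)) by apply/tuple_uniqP.
exists (perm inj_l) => j; rewrite permE (tnth_nth j) /= nth_cat -cardE.
case: ltnP => jS; first by rewrite -mem_enum mem_nth // -cardE.
apply/negbTE; rewrite -finset.in_setC -mem_enum mem_nth // -cardE.
by rewrite -(ltn_add2l #|S|) subnKC // cardsC card_ord.
Qed.

(** Exchangeability is applied to a permutation carrying the initial segment onto [S] and to the set
    [B] of tuples with entry 1 in the first [#|S|] places. *)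
Lemma exchangeable_probability {d : measure_display} {T : measurableType d}
    {R : realType} (P : probability T R) {n : nat} {A : 'I_n -> set T}
    (S : {set 'I_n}) : exchangeable_events P A ->
  P [set w | S \subset occurring A w] =
  P (\bigcap_(j in [set j : 'I_n | (j < #|S|)%N]) A j).
Proof.
move=> exA; have [s sS] := perm_initial_segment S.
pose B : set (n.-tuple R) :=
  \bigcap_(j in [set j : 'I_n | (j < #|S|)%N]) ((fun t => tnth t j) @^-1` [set 1]).
have mB : measurable B.
  apply: fin_bigcap_measurable => [|j _]; first exact: finite_finset.
  by rewrite -[_ @^-1` _]setTI; apply: measurable_tnth.
have := exA s B mB; rewrite /pushforward.
have indic1 (C : set T) w : (\1_C w = 1 :> R) <-> C w.
  rewrite indicE; split => [|/mem_set->//].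
  by case: (boolP (w \in C)) => [/set_mem//|_ /eqP]; rewrite eq_sym oner_eq0.
have -> : (fun w => [tuple \1_(A (s j)) w : R | j < n]) @^-1` B =
    [set w | S \subset occurring A w].
  apply/seteqP; split => [w Bw|w /fintype.subsetP Sw j /= jS].
    apply/fintype.subsetP => i iS; rewrite inE; apply/mem_set.
    have := Bw ((s^-1)%g i); rewrite /= -sS permKV => /(_ iS).
    by rewrite tnth_mktuple permKV => /indic1.
  rewrite tnth_mktuple; apply/indic1.
  by apply: set_mem; rewrite -in_occurring; apply: Sw; rewrite sS.
have -> : (fun w => [tuple \1_(A j) w : R | j < n]) @^-1` B =
    \bigcap_(j in [set j : 'I_n | (j < #|S|)%N]) A j.
  apply/seteqP; split => w Aw j jS; have := Aw j jS.
    by rewrite /= tnth_mktuple => /indic1.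
  by rewrite /= tnth_mktuple => /indic1.
exact.
Qed.

(** Double counting: ['C(#|U|, k)] is the number of [k]-subsets [S] of [U]. After the sums are
    swapped, each of the ['C(n, k)] sets [S] contributes the same probability. For [n < k] both
    sides vanish. *)
Lemma exchangeable_binomial_moment {d : measure_display} {T : measurableType d}
    {R : realType} {P : probability T R} {n : nat} {A : 'I_n -> set T}
    (mA : forall j, measurable (A j)) (k : nat) : exchangeable_events P A ->
  \sum_(U : {set 'I_n}) fine (P [set w | occurring A w = U]) * 'C(#|U|, k)%:R =
  'C(n, k)%:R * fine (P (\bigcap_(j in [set j : 'I_n | (j < k)%N]) A j)).
Proof.
move=> exA.
transitivity (\sum_(S : {set 'I_n} | #|S| == k) \sum_(U : {set 'I_n} | S \subset U)
    fine (P [set w | occurring A w = U])).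
  rewrite (exchange_big_dep predT) //=; apply: eq_bigr => U _.
  rewrite sumr_const mulr_natr -cards_draws; congr (_ *+ _).
  by apply: eq_card => S; rewrite !inE andbC.
under eq_bigr => S /eqP cardS.
  rewrite -(measure_occurring P mA (fun U : {set 'I_n} => S \subset U)).
  rewrite exchangeable_probability // cardS; over.
rewrite sumr_const -[n in 'C(n, k)]card_ord -card_draws mulr_natl.
by congr (_ *+ _); apply: eq_card => S; rewrite !inE.
Qed.

(** * Distribution functions as finite sums over the naturals up to [x] *)

Lemma nat_le_real {R : realType} (x : R) :
  exists N, forall m, (m%:R <= x) = (m < N)%N.
Proof.
case: (ltP x 0) => [x0|x0].
  by exists 0%N => m; apply/negbTE; rewrite -ltNge (lt_le_trans x0).
by exists (Num.truncn x).+1 => m; rewrite ltnS truncn_ge_nat.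
Qed.

Lemma poisson_cdf {R : realType} {d : measure_display} {T : measurableType d}
    {Q : probability T R} {Y : {RV Q >-> R}} {nu : R} :
  0 < nu -> poisson_distributed nu Y ->
  forall (x : R) (N : nat), (forall m, (m%:R <= x) = (m < N)%N) ->
  cdf Y x = (\sum_(m < N) nu ^+ m / m`!%:R * expR (- nu))%:E.
Proof.
move=> nu0 poissonY x N ltN.
rewrite /cdf poissonY // /pushforward /poisson_prob nu0.
have -> : (fun m : nat => m%:R : R) @^-1` `]-oo, x] = `I_N.
  by apply/seteqP; split => m; rewrite /= in_itv /= ltN.
rewrite esum_fset => [|//|m _]; last by rewrite lee_fin poisson_pmf_ge0.
rewrite -fsbig_ord -sumEFin.
by apply: eq_bigr => m _; rewrite /poisson_pmf nu0.
Qed.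

Lemma cdf_event_count {R : realType} {d : measure_display} {T : measurableType d}
    (P : probability T R) {n : nat} {A : 'I_n -> set T}
    (mA : forall j, measurable (A j)) (x : R) (N : nat) :
  (forall m, (m%:R <= x) = (m < N)%N) ->
  cdf (event_count P mA) x =
  (\sum_(m < N) \sum_(U : {set 'I_n} | #|U| == m)
     fine (P [set w | occurring A w = U]))%:E.
Proof.
move=> ltN; rewrite /cdf /distribution /pushforward.
have countE w : event_count P mA w = #|occurring A w|%:R.
  rewrite event_countE -sum1_card natr_sum [RHS]big_mkcond.
  by apply: eq_bigr => j _; rewrite in_occurring indicE; case: ifP.
have -> : event_count P mA @^-1` `]-oo, x] = [set w | (#|occurring A w| < N)%N].
  by apply/seteqP; split => w; rewrite /= in_itv /= countE ltN.
have mO := measurable_occurring mA.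
(* Finiteness of the measure asks for a measurable event: it is a finite union of fibres of
   [occurring A]. *)
rewrite -[LHS]fineK; last first.
  apply: fin_num_measure.
  rewrite (_ : mkset _ = \bigcup_(U in [set U : {set 'I_n} | (#|U| < N)%N])
    [set w | occurring A w = U]).
    by apply: fin_bigcup_measurable => [|U _]; [exact: finite_finset|exact: mO].
  apply/seteqP; split => [w wN|w [U UN wU]]; first by exists (occurring A w).
  by rewrite /= wU.
rewrite (measure_occurring P mA (fun U : {set 'I_n} => #|U| < N)%N).
congr (_%:E).
rewrite [RHS](exchange_big_dep (fun U : {set 'I_n} => #|U| < N)%N); last first.
  by move=> m U _ /eqP->.
by apply: eq_bigr => U UN; rewrite (big_pred1 (Ordinal UN)) // => m; rewrite eq_sym.
Qed.

Theorem proposition1 (R : realType) (d : nat -> measure_display)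
    (T : forall n : nat, measurableType (d n))
    (P : forall n : nat, probability (T n) R)
    (A : forall n : nat, 'I_n -> set (T n))
    (mA : forall (n : nat) (j : 'I_n), measurable (A n j))
    (exchA : forall n : nat, (2 <= n)%N -> exchangeable_events (P n) (A n))
    (nu : R) (nu_gt0 : 0 < nu)
    (momA : forall k : nat, (1 <= k)%N ->
      ((n%:R ^+ k)%:E * P n (\bigcap_(j in [set j : 'I_n | (j < k)%N]) A n j))%E
        @[n --> \oo] --> (nu ^+ k)%:E)
    (d' : measure_display) (T' : measurableType d') (Q : probability T' R)
    (Y : {RV Q >-> R}) (poissonY : poisson_distributed nu Y) :
  cvg_in_distribution (fun n => event_count (P n) (mA n)) Y.
Proof.
pose w n (U : {set 'I_n}) := fine (P n [set t | occurring (A n) t = U]).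
have momw k : \sum_U w n U * 'C(#|U|, k)%:R @[n --> \oo] --> nu ^+ k / k`!%:R.
  pose q n := fine (P n (\bigcap_(j in [set j : 'I_n | (j < k)%N]) A n j)).
  have mq n : P n (\bigcap_(j in [set j : 'I_n | (j < k)%N]) A n j) = (q n)%:E.
    rewrite fineK //; apply: fin_num_measure.
    by apply: fin_bigcap_measurable => [|j _]; [exact: finite_finset|exact: mA].
  have cq : n%:R ^+ k * q n @[n --> \oo] --> nu ^+ k.
    have [k0|k0] := posnP k; last first.
      have /fine_cvgP[_] := momA k k0.
      by under eq_fun => n do rewrite mq -EFinM.
    (* [momA] starts at [k = 1]; for [k = 0] the empty intersection is the whole space, of
       probability 1. *)
    suff -> : (fun n => n%:R ^+ k * q n) = (fun=> nu ^+ k) by exact: cvg_cst.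
    apply/funext => n; rewrite k0 !expr0 mul1r /q k0.
    rewrite (_ : mkset _ = set0); last by apply/seteqP; split.
    by rewrite bigcap_set0 probability_setT.
  (* For [n >= 2] the binomial moment is [(n ^_ k / n ^+ k) * (n ^+ k * q n)] divided by the
     factorial of [k]. *)
  have cr := cvgMr_tmp (b := k`!%:R^-1) (cvgM (cvg_ffact_ratio R k) cq).
  rewrite mul1r in cr.
  apply: cvg_trans; last exact: cr.
  apply: near_eq_cvg; near=> n.
  have n2 : (2 <= n)%N by near: n; exact: nbhs_infty_ge.
  rewrite /w exchangeable_binomial_moment; [|exact: mA|exact: exchA].
  rewrite -/(q n) /= -bin_ffact natrM.
  have nk0 : n%:R ^+ k != 0 :> R.
    by rewrite expf_neq0 // pnatr_eq0 -lt0n (leq_trans _ n2).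
  have k0 : (k`!)%:R != 0 :> R by rewrite pnatr_eq0 -lt0n fact_gt0.
  by field; apply/andP.
have w0 n U : 0 <= w n U by exact/fine_ge0/measure_ge0.
have cmass := poisson_limit_binomial_moments w0 momw.
(* One [N] serves [Y] and every [n], so convergence of the finitely many point masses at [m < N]
   suffices. *)
move=> x _; have [N ltN] := nat_le_real x.
rewrite (poisson_cdf nu_gt0 poissonY _ _ ltN).
under eq_fun => n do rewrite (cdf_event_count _ _ _ _ ltN).
apply: cvg_EFin; first by apply: nearW.
by apply: cvg_bigsum => m _; exact: cmass.
Unshelve. all: by end_near.
Qed.
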